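(* Consider, for each $n$, the fixed-design linear model $Y_i=\mathbf{X}_i'\boldsymbol{\beta}+\varepsilon_i$, $i=1,\dots,n$, with $p_n$ covariates of which the first $k_n$ have nonzero coefficients and the remaining $m_n=p_n-k_n$ have zero coefficients, and let $\widehat{\boldsymbol{\beta}}_n=(\widehat{\boldsymbol{\beta}}_{1n}',\widehat{\boldsymbol{\beta}}_{2n}')'$ be the LS-SCAD estimator with penalty parameters $\lambda_n>0$ and $a>2$ (all as set out in the context). Suppose that: (i) the $\varepsilon_i$ are i.i.d. with mean $0$ and variance $\sigma^2$; (ii) for every $j\in\{1,\dots,p_n\}$ the $j$-th column $\mathbb{X}_{\cdot j}$ of $\mathbb{X}$ satisfies $\|\mathbb{X}_{\cdot j}\|^2=n$; (iii) $\lim_{n\to\infty}\sqrt{k_n}\,\lambda_n/\sqrt{\rho_{n,1}}=0$ and $\lim_{n\to\infty}\sqrt{p_n}/\sqrt{n\rho_{n,1}}=0$; (iv) $\lim_{n\to\infty}\sqrt{k_n}\,\lambda_n/(\sqrt{\rho_{n,1}}\min_{1\le j\le k_n}|\beta_j|)=0$, $\lim_{n\to\infty}\sqrt{p_n}/(\sqrt{n\rho_{n,1}}\min_{1\le j\le k_n}|\beta_j|)=0$, and $\lim_{n\to\infty}\sqrt{p_n/n}/\rho_{n,1}=0$; (v) $\lim_{n\to\infty}\sqrt{\max(\pi_{n,k_n},\omega_{n,m_n})\,p_n}/(\sqrt{n}\,\rho_{n,1}\lambda_n)=0$, where $\rho_{n,1}$ is the smallest eigenvalue of $n^{-1}\mathbb{X}'\mathbb{X}$,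 and $\pi_{n,k_n}$, $\omega_{n,m_n}$ are the largest eigenvalues of $n^{-1}\mathbb{X}_1'\mathbb{X}_1$ and $n^{-1}\mathbb{X}_2'\mathbb{X}_2$, respectively. Then $\lim_{n\to\infty}P(\widehat{\boldsymbol{\beta}}_{2n}=\mathbf{0}_{m_n})=1$.
   Context: Setting. For each $n$, observations $(\mathbf{X}_i,Y_i)$, $i=1,\dots,n$, satisfy $Y_i=\mathbf{X}_i'\boldsymbol{\beta}+\varepsilon_i$ (the intercept is taken to be $0$), where $\mathbf{X}_i=(X_{i1},\dots,X_{ip_n})'$ is a $p_n\times1$ vector, $\varepsilon_i$ is a random error, and $\boldsymbol{\beta}=(\beta_1,\dots,\beta_{p_n})'\in\mathbb{R}^{p_n}$. The covariates $X_{ij}$ and parameters $p_n,k_n,\boldsymbol{\beta},\lambda_n$ may depend on $n$; $a>2$ and $\sigma^2$ are fixed, and the error distribution does not change with $n$. In the fixed design setting the $X_{ij}$ are nonrandom. Write $\boldsymbol{\beta}=(\boldsymbol{\beta}_1',\boldsymbol{\beta}_2')'$ with $\boldsymbol{\beta}_1=(\beta_1,\dots,\beta_{k_n})'$ having all components nonzero and $\boldsymbol{\beta}_2=\mathbf{0}_{m_n}$, $m_n=p_n-k_n$. Let $\mathbf{Y}=(Y_1,\dots,Y_n)'$ and let $\mathbb{X}=(X_{ij})$ be the $n\times p_n$ design matrix, partitioned as $\mathbb{X}=(\mathbb{X}_1,\mathbb{X}_2)$ with $\mathbb{X}_1$ of size $n\times k_n$ and $\mathbb{X}_2$ of size $n\times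 m_n$. $\|\cdot\|$ is the Euclidean norm. Conditions with $\rho_{n,1}$ in a denominator are understood with $\rho_{n,1}>0$. SCAD penalty. For $a>2$, $\lambda>0$: $p_\lambda(\theta;a)=\lambda|\theta|$ if $|\theta|\le\lambda$; $p_\lambda(\theta;a)=-(\theta^2-2a\lambda|\theta|+\lambda^2)/[2(a-1)]$ if $\lambda<|\theta|\le a\lambda$; $p_\lambda(\theta;a)=(a+1)\lambda^2/2$ if $|\theta|>a\lambda$. LS-SCAD estimator. $\widehat{\boldsymbol{\beta}}_n=\arg\min_{\mathbf{b}\in\mathbb{R}^{p_n}}Q_n(\mathbf{b};\lambda_n,a)$, where $Q_n(\mathbf{b};\lambda_n,a)=\|\mathbf{Y}-\mathbb{X}\mathbf{b}\|^2+n\sum_{j=1}^{p_n}p_{\lambda_n}(b_j;a)$ (a global minimizer). It is partitioned as $\widehat{\boldsymbol{\beta}}_n=(\widehat{\boldsymbol{\beta}}_{1n}',\widehat{\boldsymbol{\beta}}_{2n}')'$ with $\widehat{\boldsymbol{\beta}}_{1n}\in\mathbb{R}^{k_n}$, $\widehat{\boldsymbol{\beta}}_{2n}\in\mathbb{R}^{m_n}$. *)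

(* Defs.v *)
(* MathComp-Analysis *)
From HB Require Import structures.
From mathcomp Require Import all_boot all_order all_algebra.
From mathcomp Require Import all_classical all_reals all_analysis.
Import Order.TTheory GRing.Theory Num.Theory.
Import numFieldNormedType.Exports.

Set Implicit Arguments.
Unset Strict Implicit.
Unset Printing Implicit Defensive.

Local Open Scope classical_set_scope.
Local Open Scope ring_scope.

(* The norm `|v| that the library puts on matrices is the sup norm. *)
Definition l2norm (R : realType) (n : nat) (v : 'cV[R]_n) : R :=
  Num.sqrt (\sum_(i < n) v i 0 ^+ 2).

Definition gram (R : realType) (n p : nat) (X : 'M[R]_(n, p)) : 'M[R]_p :=
  n%:R^-1 *: (X^T *m X).

(* The set of eigenvalues is finite, and for a symmetric matrix of positive size
   it is nonempty, so that the extrema are attained; both are 0 in size 0. *)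
Definition min_eigenvalue (R : realType) (p : nat) (A : 'M[R]_p) : R :=
  inf [set a | eigenvalue A a].

Definition max_eigenvalue (R : realType) (p : nat) (A : 'M[R]_p) : R :=
  sup [set a | eigenvalue A a].

(* The minimum of the |v_j|.  It is 0 for k = 0, so that a quotient by it is
   then 0, in agreement with the convention that an empty minimum is +oo. *)
Definition min_abs (R : realType) (k : nat) (v : 'cV[R]_k) : R :=
  inf (range (fun j : 'I_k => `|v j 0|)).

Definition scad (R : realType) (lambda a theta : R) : R :=
  if `|theta| <= lambda then lambda * `|theta|
  else if `|theta| <= a * lambda then
    - (theta ^+ 2 - 2 * a * lambda * `|theta| + lambda ^+ 2) / (2 * (a - 1))
  else (a + 1) * lambda ^+ 2 / 2.

Definition scad_criterion (R : realType) (n p : nat) (X : 'M[R]_(n, p))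
    (Y : 'cV[R]_n) (lambda a : R) (b : 'cV[R]_p) : R :=
  l2norm (Y - X *m b) ^+ 2 + n%:R * \sum_(j < p) scad lambda a (b j 0).

(* Global minimizers need not be unique. *)
Definition is_ls_scad (R : realType) (n p : nat) (X : 'M[R]_(n, p))
    (Y : 'cV[R]_n) (lambda a : R) (b : 'cV[R]_p) : Prop :=
  forall c : 'cV[R]_p,
    scad_criterion X Y lambda a b <= scad_criterion X Y lambda a c.

Definition mutually_independent (d : measure_display) (T : measurableType d)
    (R : realType) (P : probability T R) (I : finType)
    (Z : I -> {RV P >-> R}) : Prop :=
  forall (J : {set I}) (A : I -> set R),
    (forall i, measurable (A i)) ->
    P (\bigcap_(i in [set` J]) (Z i @^-1` A i)) =
      (\prod_(i in J) P (Z i @^-1` A i))%E.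

Definition identically_distributed (d : measure_display) (T : measurableType d)
    (R : realType) (P : probability T R) (Z W : {RV P >-> R}) : Prop :=
  forall A : set R, measurable A -> distribution P Z A = distribution P W A.

Definition random_vector (d : measure_display) (T : measurableType d)
    (R : realType) (p : nat) (V : T -> 'cV[R]_p) : Prop :=
  forall j : 'I_p, measurable_fun [set: T] (fun w => V w j 0).

(* Main.v *)
Require Import Defs.
From HB Require Import structures.
From mathcomp Require Import all_boot all_order all_algebra.
From mathcomp Require Import all_classical all_reals all_analysis.
From mathcomp Require Import measurable_realfun ring lra.
Import Order.TTheory GRing.Theory Num.Theory.
Import numFieldNormedType.Exports.

Set Implicit Arguments.
Unset Strict Implicit.
Unset Printing Implicit Defensive.

Local Open Scope classical_set_scope.
Local Open Scope ring_scope.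

(* Let Pi be the orthogonal projection onto the column space of X, p = k + m,
   delta = betahat - beta, and work on the event |Pi eps| < S with S = q sqrt p.
   As E |Pi eps|^2 = sigma^2 p, Markov's inequality gives this event probability
   at least 1 - sigma^2 / q^2.

   Comparing betahat with beta yields
     |X delta|^2 <= 2 S |X delta| + n k (a + 1) lambda^2 / 2,
   hence |delta| <= (2 S + sqrt(n k (a + 1) / 2) lambda) / sqrt(n rho), so that by
   (iv) all coordinates of beta_1 and of betahat_1 lie in the flat region of the
   penalty.  Their penalties then cancel, and the comparison improves to
   |X delta| <= 2 S and |delta| <= 2 S / sqrt(n rho), which is o(lambda) by (v)
   since rho <= 1 <= max(pi, omega).

   If some coordinate u of betahat_2 were nonzero, comparing betahat with the
   vector in which u is replaced by 0 would give
   n lambda |u| <= 2 |u| * 3 S sqrt n + n u^2, that is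
   lambda <= 6 S / sqrt n + |u| <= 8 S / sqrt(n rho), a contradiction. *)

(** * Inner product and extreme eigenvalues *)

Definition dot (R : realType) (n : nat) (u v : 'cV[R]_n) : R :=
  \sum_(i < n) u i 0 * v i 0.

Section dot.
Variable R : realType.

Lemma dotE n (u v : 'cV[R]_n) : dot u v = (u^T *m v) 0 0.
Proof. by rewrite mxE; apply: eq_bigr => i _; rewrite mxE. Qed.

Lemma dotC n (u v : 'cV[R]_n) : dot u v = dot v u.
Proof. by apply: eq_bigr => i _; rewrite mulrC. Qed.

Lemma dotDl n (u v w : 'cV[R]_n) : dot (u + v) w = dot u w + dot v w.
Proof. by rewrite -big_split; apply: eq_bigr => i _; rewrite mxE mulrDl. Qed.

Lemma dotZl n (c : R) (u v : 'cV[R]_n) : dot (c *: u) v = c * dot u v.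
Proof. by rewrite mulr_sumr; apply: eq_bigr => i _; rewrite mxE mulrA. Qed.

Lemma dotNl n (u v : 'cV[R]_n) : dot (- u) v = - dot u v.
Proof. by rewrite -scaleN1r dotZl mulN1r. Qed.

Lemma dotDr n (u v w : 'cV[R]_n) : dot w (u + v) = dot w u + dot w v.
Proof. by rewrite dotC dotDl !(dotC w). Qed.

Lemma dotZr n (c : R) (u v : 'cV[R]_n) : dot u (c *: v) = c * dot u v.
Proof. by rewrite dotC dotZl dotC. Qed.

Lemma dotNr n (u v : 'cV[R]_n) : dot u (- v) = - dot u v.
Proof. by rewrite dotC dotNl dotC. Qed.

Lemma dot_mulmxl n m (A : 'M[R]_(n, m)) (u : 'cV[R]_m) (v : 'cV[R]_n) :
  dot (A *m u) v = dot u (A^T *m v).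
Proof. by rewrite !dotE trmx_mul mulmxA. Qed.

Lemma l2norm_sqr n (v : 'cV[R]_n) : l2norm v ^+ 2 = dot v v.
Proof.
rewrite sqr_sqrtr; last by apply: sumr_ge0 => i _; exact: sqr_ge0.
by apply: eq_bigr => i _; rewrite expr2.
Qed.

Lemma l2norm_ge0 n (v : 'cV[R]_n) : 0 <= l2norm v.
Proof. exact: sqrtr_ge0. Qed.

Lemma dot_ge0 n (v : 'cV[R]_n) : 0 <= dot v v.
Proof. by rewrite -l2norm_sqr sqr_ge0. Qed.

Lemma dot_eq0 n (v : 'cV[R]_n) : dot v v = 0 -> v = 0.
Proof.
move=> /psumr_eq0P v0; apply/matrixP => i j; rewrite ord1 mxE.
by apply/eqP; rewrite -sqrf_eq0 expr2 v0// => k _; rewrite -expr2 sqr_ge0.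
Qed.

Lemma dot_gt0 n (v : 'cV[R]_n) : v != 0 -> 0 < dot v v.
Proof.
move=> v0; rewrite lt_neqAle dot_ge0 eq_sym andbT.
by apply: contra_neq v0 => /dot_eq0.
Qed.

Lemma ler_norm_l2norm n (v : 'cV[R]_n) i : `|v i 0| <= l2norm v.
Proof.
rewrite -(ler_pXn2r (n := 2)) ?nnegrE ?l2norm_ge0// l2norm_sqr.
rewrite real_normK ?num_real// expr2 /dot (bigD1 i)//= lerDl.
by apply: sumr_ge0 => k _; rewrite -expr2 sqr_ge0.
Qed.

Lemma cauchy_schwarz n (u v : 'cV[R]_n) : `|dot u v| <= l2norm u * l2norm v.
Proof.
have [->|v0] := eqVneq v 0.
  rewrite -(scale0r (0 : 'cV[R]_n)) dotZr mul0r normr0.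
  by rewrite mulr_ge0// l2norm_ge0.
have vv := dot_gt0 v0.
rewrite -(ler_pXn2r (n := 2)) ?nnegrE ?mulr_ge0 ?l2norm_ge0//.
rewrite exprMn !l2norm_sqr real_normK ?num_real//.
(* This squared norm expands to [dot v v] times the gap between the two squared sides. *)
have := dot_ge0 (dot v v *: u - dot u v *: v).
rewrite !(dotDl, dotDr, dotNl, dotNr, dotZl, dotZr) (dotC v u) => h.
rewrite -subr_ge0 -(pmulr_rge0 _ vv); apply: le_trans h _.
by rewrite le_eqVlt; apply/orP; left; apply/eqP; ring.
Qed.

End dot.

(* The minimum of the quadratic form on the compact unit sphere is attained at an
   eigenvector; this replaces the spectral theorem. *)
Lemma rayleigh_min (R : realType) (p : nat) (A : 'M[R]_p) :
  (0 < p)%N -> A^T = A ->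
  exists2 mu, eigenvalue A mu & forall v, mu * dot v v <= dot v (A *m v).
Proof.
move=> p0 AT.
(* Row vectors, because the witnesses of [eigenvalue] are left eigenvectors; [q 1%:M] is the squared
   Euclidean norm. *)
pose q (B : 'M[R]_p) (v : 'rV[R]_p) := dot v^T (B *m v^T).
have qc B : continuous (q B).
  have -> : q B = fun v => \sum_i \sum_j v 0 i * B i j * v 0 j.
    apply/funext => v; apply: eq_bigr => i _; rewrite !mxE mulr_sumr.
    by apply: eq_bigr => j _; rewrite !mxE mulrA.
  have addc : continuous (fun x : R * R => x.1 + x.2) by exact: add_continuous.
  apply: continuous_big => // i _; apply: continuous_big => // j _ v.
  apply: (continuousM (s := fun v : 'rV[R]_p => v 0 i * B i j));
    last exact: coord_continuous.
  apply: (continuousM (s := fun v : 'rV[R]_p => v 0 i)); last exact: cst_continuous.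
  exact: coord_continuous.
have q1 v : q 1%:M v = dot v^T v^T by rewrite /q mul1mx.
pose S := [set v | q 1%:M v = 1].
have cS : compact S.
  apply: bounded_closed_compact; last first.
    apply: (@preimage_closed _ _ (q 1%:M) [set 1]); last exact: closed_eq.
    by move=> v _; exact: qc.
  exists 1; split=> // M M1 v; rewrite /S /= q1 => v1.
  rewrite [leLHS]/Num.norm /= mx_normrE; apply/bigmax_leP; split.
    by rewrite (le_trans ler01)// ltW.
  case=> i j _ /=; rewrite ord1 (le_trans _ (ltW M1))//.
  have := ler_norm_l2norm v^T j; rewrite mxE => /le_trans; apply.
  by rewrite -(ler_pXn2r (n := 2)) ?nnegrE ?l2norm_ge0// l2norm_sqr v1 expr1n.
have S0 : S !=set0.
  exists (delta_mx 0 (Ordinal p0)); rewrite /S /= q1 /dot (bigD1 (Ordinal p0))//=.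
  rewrite !mxE !eqxx mulr1 big1 ?addr0// => i /negPf i0.
  by rewrite !mxE i0 mulr0.
have cq : {within S, continuous (q A)} by exact: continuous_subspaceT (qc A).
have [v0 + v0min] := compact_EVT_min S0 cS cq.
rewrite inE /S /= q1 => v01.
pose mu := q A v0; pose x := v0^T.
pose f (v : 'cV[R]_p) := dot v (A *m v) - mu * dot v v.
have f0 v : 0 <= f v.
  have [->|v_neq0] := eqVneq v 0.
    rewrite /f -(scale0r (0 : 'cV[R]_p)) -scalemxAr !dotZl !mul0r mulr0 subr0.
    by [].
  have vv := dot_gt0 v_neq0.
  have nv : l2norm v != 0 by rewrite -sqrf_eq0 l2norm_sqr gt_eqF.
  (* By homogeneity, minimality on the unit sphere extends to every nonzero vector. *)
  have : q A v0 <= q A ((l2norm v)^-1 *: v)^T.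
    apply: v0min; rewrite inE /S /= q1 trmxK dotZl dotZr -l2norm_sqr.
    by rewrite mulrA -expr2 -exprMn mulVf// expr1n.
  rewrite /q trmxK -scalemxAr dotZl dotZr mulrA -expr2 -/mu exprVn.
  by rewrite l2norm_sqr mulrC ler_pdivlMr// /f subr_ge0.
exists mu; last by move=> v; rewrite -subr_ge0; exact: f0.
(* At a zero of a nonnegative quadratic form its polar form vanishes. *)
have [w wE] : exists w, w = A *m x - mu *: x by exists (A *m x - mu *: x).
have fx : dot x (A *m x) = mu by [].
have xx : dot x x = 1 by [].
pose s := dot w w; pose c := f w.
have fxw t : f (x + t *: w) = 2 * t * s + t ^+ 2 * c.
  rewrite /c /f mulmxDr -scalemxAr !(dotDl, dotDr, dotZl, dotZr) fx xx.
  have -> : dot x (A *m w) = dot w (A *m x) by rewrite -[in LHS]AT -dot_mulmxl dotC.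
  have -> : s = dot w (A *m x) - mu * dot w x by rewrite /s {2}wE dotDr dotNr dotZr.
  rewrite (dotC x w).
  ring.
have s0 : 0 <= s by exact: dot_ge0.
have c0 : 0 <= c by exact: f0.
have /dot_eq0 w0 : s = 0.
  (* The step is [- s / (c + 1)] rather than the minimizer [- s / c], since [c] may vanish; the
     value obtained is negative unless [s = 0]. *)
  have := f0 (x + (- (s / (c + 1))) *: w); rewrite fxw.
  have c1 : 0 < c + 1 by rewrite ltr_wpDl.
  have -> : 2 * (- (s / (c + 1))) * s + (- (s / (c + 1))) ^+ 2 * c =
     - (s ^+ 2 * (c + 2)) / (c + 1) ^+ 2 by field; rewrite gt_eqF.
  rewrite pmulr_lge0 ?invr_gt0 ?exprn_gt0// oppr_ge0 pmulr_lle0; last first.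
    by rewrite ltr_wpDl.
  by move=> h; apply/eqP; rewrite -sqrf_eq0 eq_le h sqr_ge0.
apply/eigenvalueP; exists v0.
  apply: trmx_inj; rewrite trmx_mul AT linearZ /=.
  by apply: subr0_eq; rewrite -wE.
apply/negP => /eqP v00; move: v01; rewrite v00 trmx0 /dot big1 => [/eqP|i _].
  by rewrite eq_sym oner_eq0.
by rewrite mxE mul0r.
Qed.

Section extreme_eigenvalues.
Variables (R : realType) (p : nat) (A : 'M[R]_p).
Hypothesis AT : A^T = A.

Let dot0 (v w : 'cV[R]_p) : (p <= 0)%N -> dot v w = 0.
Proof. by move=> p0; apply: big1 => i _; have := leq_trans (ltn_ord i) p0. Qed.

Lemma dot_eigenvector (a : R) (v : 'rV[R]_p) :
  v *m A = a *: v -> dot v^T (A *m v^T) = a * dot v^T v^T.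
Proof. by move=> va; rewrite -{1}AT -trmx_mul va linearZ dotZr. Qed.

(** The Rayleigh minimum [mu] is an eigenvalue and a lower bound of all eigenvalues, so the infimum
    is taken over a set bounded below and is at most [mu]. In size 0 both sides are 0. *)
Lemma min_eigenvalue_le v : min_eigenvalue A * dot v v <= dot v (A *m v).
Proof.
have [/dot0 v0|p0] := leqP p 0; first by rewrite !v0 mulr0.
have [mu Amu muP] := rayleigh_min p0 AT.
rewrite (le_trans _ (muP v))// ler_wpM2r ?dot_ge0// /min_eigenvalue.
apply: ge_inf => //=; exists mu => a /eigenvalueP[w wa w0].
have /dot_gt0 ww : w^T != 0 by apply: contra_neq w0 => w0; rewrite -[w]trmxK w0 trmx0.
by rewrite -(ler_pM2r ww) -(dot_eigenvector wa).
Qed.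

(** The Rayleigh minimum of [- A] is, up to sign, an attained maximum for [A]. *)
Lemma max_eigenvalue_ge v : dot v (A *m v) <= max_eigenvalue A * dot v v.
Proof.
have [/dot0 v0|p0] := leqP p 0; first by rewrite !v0 mulr0.
have [|mu Amu muP] := @rayleigh_min _ _ (- A) p0; first by rewrite linearN /= AT.
have {}muP u : dot u (A *m u) <= - mu * dot u u.
  by rewrite mulNr lerNr -dotNr -mulNmx.
rewrite (le_trans (muP v))// ler_wpM2r ?dot_ge0// /max_eigenvalue.
apply: ub_le_sup => /=; last first.
  move: Amu => /eigenvalueP[w wa w0]; apply/eigenvalueP; exists w => //.
  by rewrite scaleNr -wa mulmxN opprK.
exists (- mu) => a /eigenvalueP[w wa w0].
have /dot_gt0 ww : w^T != 0 by apply: contra_neq w0 => w0; rewrite -[w]trmxK w0 trmx0.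
by rewrite -(ler_pM2r ww) -(dot_eigenvector wa).
Qed.

End extreme_eigenvalues.

(** * Gram matrices and the projection onto the column space *)

Section gram.
Variables (R : realType) (n p : nat) (X : 'M[R]_(n, p)).

Lemma trmx_gram : (gram X)^T = gram X.
Proof. by rewrite /gram linearZ /= trmx_mul trmxK. Qed.

Lemma dot_gram v : dot v (gram X *m v) = n%:R^-1 * dot (X *m v) (X *m v).
Proof. by rewrite /gram -scalemxAl dotZr dot_mulmxl mulmxA. Qed.

(** Turns a bound on the prediction error into a bound on the coefficients. *)
Lemma min_eigenvalue_gram v : (0 < n)%N ->
  n%:R * min_eigenvalue (gram X) * l2norm v ^+ 2 <= l2norm (X *m v) ^+ 2.
Proof.
move=> n0; rewrite !l2norm_sqr -mulrA mulrC -ler_pdivlMr ?ltr0n//.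
by rewrite [leRHS]mulrC -dot_gram min_eigenvalue_le// trmx_gram.
Qed.

(** Normalized columns put 1 on the diagonal of the Gram matrix; as Rayleigh quotients at basis
    vectors, these entries place 1 between the extreme eigenvalues. *)
Lemma dot_delta_gram j : (0 < n)%N -> l2norm (col j X) ^+ 2 = n%:R ->
  dot (delta_mx j 0) (gram X *m delta_mx j 0) = 1.
Proof.
by move=> n0; rewrite l2norm_sqr dot_gram colE => ->; rewrite mulVf// pnatr_eq0 -lt0n.
Qed.

Lemma dot_delta (j : 'I_p) : dot (delta_mx j 0 : 'cV[R]_p) (delta_mx j 0) = 1.
Proof.
rewrite /dot (bigD1 j)//= !mxE !eqxx mulr1 big1 ?addr0// => i /negPf ij.
by rewrite !mxE ij mul0r.
Qed.

Lemma min_eigenvalue_gram_le1 j : (0 < n)%N -> l2norm (col j X) ^+ 2 = n%:R ->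
  min_eigenvalue (gram X) <= 1.
Proof.
move=> n0 cj; rewrite -(dot_delta_gram n0 cj) -[leLHS]mulr1 -(dot_delta j).
exact/min_eigenvalue_le/trmx_gram.
Qed.

Lemma max_eigenvalue_gram_ge1 j : (0 < n)%N -> l2norm (col j X) ^+ 2 = n%:R ->
  1 <= max_eigenvalue (gram X).
Proof.
move=> n0 cj; rewrite -(dot_delta_gram n0 cj) -[leRHS]mulr1 -(dot_delta j).
exact/max_eigenvalue_ge/trmx_gram.
Qed.

(** The witness is the hat matrix X (X'X)^-1 X'. Its trace is the source of the factor p in the mean
    squared norm of the projected noise. *)
Lemma column_space_projection : (0 < n)%N -> 0 < min_eigenvalue (gram X) ->
  exists A : 'M[R]_n, [/\ A^T = A, A *m A = A, A *m X = X & \tr A = p%:R].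
Proof.
move=> n0 rho0; pose G := X^T *m X.
(* A vector in the kernel of X'X is killed by X, and the positive smallest eigenvalue then forces it
   to be 0. *)
have Gu : G \in unitmx.
  rewrite -row_free_unit; apply: inj_row_free => v vG.
  have GT : G^T = G by rewrite /G trmx_mul trmxK.
  have Xv : l2norm (X *m v^T) ^+ 2 = 0.
    rewrite l2norm_sqr dot_mulmxl mulmxA -/G -GT -trmx_mul vG trmx0.
    by rewrite -(scale0r (0 : 'cV[R]_p)) dotZr mul0r.
  have := min_eigenvalue_gram v^T n0; rewrite Xv pmulr_rle0; last first.
    by rewrite mulr_gt0 ?ltr0n.
  move=> v0; apply: trmx_inj; rewrite trmx0; apply: dot_eq0.
  by apply/eqP; rewrite eq_le dot_ge0 -l2norm_sqr v0.
exists (X *m invmx G *m X^T); split.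
- by rewrite !trmx_mul trmxK mulmxA trmx_inv trmx_mul trmxK.
- by rewrite !mulmxA -(mulmxA _ X^T) -/G mulmxKV.
- by rewrite -mulmxA -/G mulmxKV.
- by rewrite mxtrace_mulC mulmxA mulmxV// mxtrace1.
Qed.

End gram.

(** * Moments of quadratic forms in independent errors *)

Section independence.
Context (d : measure_display) (T : measurableType d) (R : realType).
Variable P : probability T R.
Implicit Types Z W : {RV P >-> R}.
Local Open Scope ereal_scope.

(* The joint law of an independent pair is the product of the marginal laws. *)
Lemma integral_mul_independent Z W :
  (forall A B : set R, measurable A -> measurable B ->
    P ((Z @^-1` A) `&` (W @^-1` B)) = P (Z @^-1` A) * P (W @^-1` B)) ->
  P.-integrable setT (EFin \o Z) -> P.-integrable setT (EFin \o W) ->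
  P.-integrable setT (fun w => (Z w * W w)%:E) /\
  \int[P]_w (Z w * W w)%:E = (\int[P]_w (Z w)%:E) * (\int[P]_w (W w)%:E).
Proof.
move=> indep iZ iW.
pose h w := (Z w, W w).
have mh : measurable_fun setT h by exact: measurable_fun_pair.
pose H : {mfun T >-> (R * R)%type} := HB.pack h (isMeasurableFun.Build _ _ _ _ h mh).
pose g (z : R * R) : R := (z.1 * z.2)%R.
pose f : R * R -> \bar R := EFin \o g.
have mg : measurable_fun [set: R * R] g by exact: measurable_funM.
have mf : measurable_fun [set: R * R] f by exact/measurable_EFinP.
(* The two measures agree on rectangles, which determine the product measure. *)
have lawE : forall U, measurable U ->
    (distribution P Z \x distribution P W) U = distribution P H U.
  by apply: product_measure_unique => A B mA mB; rewrite -indep.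
have iid (V : {RV P >-> R}) : P.-integrable setT (EFin \o V) ->
    (distribution P V).-integrable setT EFin.
  by move=> iV; apply: integrable_pushforward.
have fin_int (V : {RV P >-> R}) : P.-integrable setT (EFin \o V) ->
    \int[distribution P V]_y y%:E = \int[P]_w (V w)%:E.
  by move=> iV; rewrite integral_distribution.
(* By Tonelli, the absolute moment of the product factors into two finite first absolute moments. *)
have if_prod : (distribution P Z \x distribution P W).-integrable setT f.
  apply/integrable12ltyP => //.
  have /integrableP[_ iZ'] := iid _ iZ; have /integrableP[_ iW'] := iid _ iW.
  have fE (x : R) : \int[distribution P W]_y `|f (x, y)| =
      `|x%:E| * \int[distribution P W]_y `|y%:E|.
    rewrite -ge0_integralZl//; last exact: measurableT_comp.
    by apply: eq_integral => y _; rewrite -abseM.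
  under eq_integral => x _ do rewrite fE.
  rewrite ge0_integralZr//; last by apply: integral_ge0.
    apply: lte_mul_pinfty => //; first exact: integral_ge0.
    by rewrite ge0_fin_numE// integral_ge0.
  exact: measurableT_comp.
have if_law : (distribution P H).-integrable setT f.
  apply/integrableP; split=> //; have /integrableP[_] := if_prod.
  by rewrite (eq_measure_integral (distribution P H))// => A mA _; exact: lawE.
have iZW : P.-integrable setT (fun w => (Z w * W w)%:E).
  apply/integrableP; split.
    by apply/measurable_EFinP; exact: measurable_funM.
  have /integrableP[_] := if_law.
  by rewrite ge0_integral_distribution//; exact: measurableT_comp.
split=> //.
have <- : \int[distribution P H]_z f z = \int[P]_w (Z w * W w)%:E.
  by rewrite integral_distribution.
rewrite (eq_measure_integral (distribution P Z \x distribution P W)); last first.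
  by move=> A mA _; exact/esym/lawE.
rewrite -integral12_prod_meas1//= /fubini_F /f /=.
rewrite -(fin_int Z)// -(fin_int W)//.
have iWfin : \int[distribution P W]_y y%:E \is a fin_num.
  exact/integrable_fin_num/iid.
rewrite -(fineK iWfin) -integralZr//; last exact: iid.
apply: eq_integral => x _; rewrite fineK// -integralZl//; last exact: iid.
Qed.

Lemma integral_sqr_variance Z : 'E_P[Z] = 0 -> 'V_P[Z] = \int[P]_w (Z w * Z w)%:E.
Proof.
move=> EZ; rewrite /variance unlock EZ/= unlock.
apply: eq_integral => w _; pose z : R := fine (0 : \bar R).
by rewrite -[LHS]/(((Z w - z) * (Z w - z))%R%:E) !subr0.
Qed.

Lemma integrable_sqr Z (s : R) : 'E_P[Z] = 0 -> 'V_P[Z] = s%:E ->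
  P.-integrable setT (fun w => (Z w * Z w)%:E).
Proof.
move=> EZ VZ; apply/integrableP; split.
  by apply/measurable_EFinP; exact: measurable_funM.
under eq_integral => w _ do rewrite gee0_abs ?lee_fin -?expr2 ?sqr_ge0//.
by under eq_integral => w _ do rewrite expr2; rewrite -integral_sqr_variance// VZ ltry.
Qed.

(** Domination by 1 + z^2, where the constant is integrable because [P] is a probability. *)
Lemma integrable_of_sqr Z : P.-integrable setT (fun w => (Z w * Z w)%:E) ->
  P.-integrable setT (EFin \o Z).
Proof.
move=> iZZ; apply: (@le_integrable _ _ _ _ _ _ _ (fun w => 1 + (Z w * Z w)%:E)) => //.
- exact/measurable_EFinP.
- move=> w _ /=; rewrite lee_fin; rewrite [leRHS]ger0_norm; last first.
    by rewrite addr_ge0// -expr2 sqr_ge0.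
  move: (Z w) => z; rewrite ler_norml.
  by have := sqr_ge0 (z - 2^-1)%R; have := sqr_ge0 (z + 2^-1)%R; rewrite !expr2; lra.
- apply: integrableD => //; apply/integrableP; split => //.
  by rewrite integral_cst//= normr1 mul1e probability_setT ltry.
Qed.

Lemma quadratic_formE (n : nat) (v : 'I_n -> R) (A : 'M[R]_n) :
  (dot (\col_i v i) (A *m \col_i v i) =
   \sum_i \sum_j A i j * (v i * v j))%R.
Proof.
apply: eq_bigr => i _; rewrite !mxE mulr_sumr; apply: eq_bigr => j _.
by rewrite !mxE; ring.
Qed.

(** Independence and zero means kill the off-diagonal terms; each diagonal entry of [A] is
    multiplied by the variance. *)
Lemma expectation_quadratic_form (n : nat) (e : 'I_n -> {RV P >-> R}) (s : R)
    (A : 'M[R]_n) :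
  mutually_independent e -> (forall i, 'E_P[e i] = 0) ->
  (forall i, 'V_P[e i] = s%:E) ->
  \int[P]_w (dot (\col_i e i w) (A *m \col_i e i w))%:E = (s * \tr A)%:E.
Proof.
move=> indep mean var.
have iee i : P.-integrable setT (fun w => (e i w * e i w)%:E).
  exact: integrable_sqr (var i).
have ie i : P.-integrable setT (EFin \o e i) by exact: integrable_of_sqr.
have pair i j : i != j ->
    P.-integrable setT (fun w => (e i w * e j w)%:E) /\
    \int[P]_w (e i w * e j w)%:E = 0.
  move=> ij; have [|//|//|iij ->] := @integral_mul_independent (e i) (e j).
    move=> B C mB mC.
    (* Pairwise independence is joint independence restricted to the index set {i, j}. *)
    have := indep [set i; j]%SET (fun k => if k == i then B else C).
    rewrite big_setU1 ?inE//= big_set1 eqxx [j == i]eq_sym (negPf ij) => <-.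
      congr (P _); apply/seteqP; split => w /=.
        move=> [wB wC] k /=; rewrite !inE => /orP[]/eqP->; rewrite ?eqxx//.
        by rewrite eq_sym (negPf ij).
      move=> h; split; have := h _ _.
        by move=> /(_ i); rewrite /= !inE eqxx; exact.
      by move=> /(_ j); rewrite /= !inE eqxx orbT eq_sym (negPf ij); exact.
    by move=> k; case: ifP.
  by split=> //; have := mean i; rewrite unlock => ->; rewrite mul0e.
have ijP i j : P.-integrable setT (fun w => (e i w * e j w)%:E).
  by have [->|/pair[]] := eqVneq i j.
transitivity (\int[P]_w \sum_i \sum_j (A i j)%:E * (e i w * e j w)%:E).
  apply: eq_integral => w _; rewrite quadratic_formE -sumEFin.
  by apply: eq_bigr => i _; rewrite -sumEFin.
have iA i j : P.-integrable setT (fun w => (A i j)%:E * (e i w * e j w)%:E).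
  exact: integrableZl.
rewrite integral_sum//; last by move=> i; exact: integrable_sum.
rewrite /mxtrace mulr_sumr -sumEFin; apply: eq_bigr => i _.
rewrite integral_sum// (bigD1 i)//= big1 ?adde0.
  by rewrite integralZl// -integral_sqr_variance// var -EFinM mulrC.
by move=> j ji; rewrite integralZl// (pair i j _).2 ?mule0// eq_sym.
Qed.

Lemma measurable_quadratic_form (n : nat) (e : 'I_n -> {RV P >-> R})
    (A : 'M[R]_n) :
  measurable_fun setT (fun w => dot (\col_i e i w) (A *m \col_i e i w)).
Proof.
under eq_fun do rewrite quadratic_formE.
apply: measurable_sum => i; apply: measurable_sum => j.
by apply: measurable_funM => //; exact: measurable_funM.
Qed.

(** Markov's inequality; nonnegativity of the form lets it stand for its own absolute value. *)
Lemma quadratic_form_tail (n : nat) (e : 'I_n -> {RV P >-> R}) (s t : R)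
    (A : 'M[R]_n) :
  mutually_independent e -> (forall i, 'E_P[e i] = 0) ->
  (forall i, 'V_P[e i] = s%:E) ->
  (forall v : 'cV[R]_n, (0 <= dot v (A *m v))%R) -> (0 < t)%R ->
  P [set w | (t <= dot (\col_i e i w) (A *m \col_i e i w))%R] <=
    (s * \tr A / t)%:E.
Proof.
move=> indep mean var A0 t0.
have mq := measurable_quadratic_form e A.
rewrite EFinM lee_pdivlMr// muleC -(expectation_quadratic_form A indep mean var).
pose q w := dot (\col_i e i w) (A *m \col_i e i w).
have qE w : `|(q w)%:E| = (q w)%:E by rewrite gee0_abs// lee_fin; exact: A0.
rewrite -[leRHS]/(\int[P]_w (q w)%:E).
under eq_integral => w _ do rewrite -qE.
have -> : [set w | (t <= q w)%R] = setT `&` [set w | t%:E <= `|(EFin \o q) w|].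
  rewrite setTI; apply/funext => w; congr is_true.
  by rewrite -lee_fin -qE.
by apply: (@le_integral_comp_abse _ _ _ P _ measurableT (EFin \o q) t id) => //;
  exact/measurable_EFinP.
Qed.

End independence.

(** * The penalty and its minimizers *)

Section scad.
Variables (R : realType) (lam a : R).

Lemma scad_small t : `|t| <= lam -> scad lam a t = lam * `|t|.
Proof. by rewrite /scad => ->. Qed.

Lemma scad_large t : 0 < lam -> 2 < a ->
  a * lam < `|t| -> scad lam a t = (a + 1) * lam ^+ 2 / 2.
Proof.
move=> lam0 a2 lt_t; have alam : lam < a * lam by rewrite ltr_pMl//; lra.
by rewrite /scad leNgt (lt_trans alam)//= leNgt lt_t.
Qed.

Lemma scad0 : 0 < lam -> scad lam a 0 = 0.
Proof. by move=> lam0; rewrite scad_small normr0 ?mulr0// ltW. Qed.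

Lemma scad_ge0 t : 0 < lam -> 2 < a -> 0 <= scad lam a t.
Proof.
move=> lam0 a2; rewrite /scad; case: ifPn => [_|]; first by rewrite mulr_ge0// ltW.
rewrite -ltNge => t1; case: ifPn => [t2|_]; last first.
  by rewrite divr_ge0// mulr_ge0 ?sqr_ge0//; lra.
rewrite -real_normK ?num_real//; set x := `|t| in t1 t2 *.
apply: divr_ge0; last by lra.
(* The numerator equals (a lam - x) x + (a - 2) lam x + lam (2 x - lam), each summand being
   nonnegative. *)
have : 0 <= (a * lam - x) * x by rewrite mulr_ge0//; lra.
have : 0 <= (a - 2) * lam * x by rewrite !mulr_ge0//; lra.
by nra.
Qed.

Lemma scad_le t : 0 < lam -> 2 < a ->
  scad lam a t <= (a + 1) * lam ^+ 2 / 2.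
Proof.
move=> lam0 a2; rewrite /scad; case: ifPn => [t1|_].
  have : 0 <= lam * (lam - `|t|) by rewrite mulr_ge0//; lra.
  have : 0 <= (a - 2) * lam ^+ 2 by rewrite mulr_ge0 ?sqr_ge0//; lra.
  by nra.
case: ifPn => // _; rewrite ler_pdivrMr; last lra.
rewrite -real_normK ?num_real//; set x := `|t|.
(* After clearing the denominator, the gap to the plateau is exactly this square. *)
have : 0 <= (x - a * lam) ^+ 2 by exact: sqr_ge0.
by nra.
Qed.

End scad.

(** * Deterministic inequalities for the estimator *)

(** Compares the criterion at [bh] and at the true [beta]; the squared norm of [e] cancels on
    expansion. *)
Lemma ls_scad_basic_inequality (R : realType) (n p : nat) (X : 'M[R]_(n, p))
    (beta bh : 'cV[R]_p) (e : 'cV[R]_n) (lam a : R) :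
  is_ls_scad X (X *m beta + e) lam a bh ->
  l2norm (X *m (bh - beta)) ^+ 2 <= 2 * dot e (X *m (bh - beta)) +
    n%:R * (\sum_j scad lam a (beta j 0) - \sum_j scad lam a (bh j 0)).
Proof.
move=> /(_ beta); rewrite /scad_criterion.
have -> : X *m beta + e - X *m bh = e - X *m (bh - beta).
  by rewrite mulmxBr opprB addrCA addrA.
rewrite addrAC subrr add0r; move: (X *m _) => x.
rewrite !l2norm_sqr !(dotDl, dotDr, dotNl, dotNr) (dotC x e).
by lra.
Qed.

(* Setting a single coordinate [i] of the estimator to zero cannot decrease the
   criterion. *)
Lemma ls_scad_coordinate_inequality (R : realType) (n p : nat)
    (X : 'M[R]_(n, p)) (beta bh : 'cV[R]_p) (e : 'cV[R]_n) (lam a : R) (i : 'I_p) :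
  0 < lam ->
  is_ls_scad X (X *m beta + e) lam a bh ->
  n%:R * scad lam a (bh i 0) <=
    2 * bh i 0 * dot (e - X *m (bh - beta)) (col i X) +
    bh i 0 ^+ 2 * l2norm (col i X) ^+ 2.
Proof.
move=> lam0 /(_ (bh - bh i 0 *: delta_mx i 0)); rewrite /scad_criterion.
set u := bh i 0.
have -> : X *m beta + e - X *m bh = e - X *m (bh - beta).
  by rewrite mulmxBr opprB addrCA addrA.
have -> : X *m beta + e - X *m (bh - u *: delta_mx i 0) =
    e - X *m (bh - beta) + u *: col i X.
  rewrite !mulmxBr -scalemxAr -colE !opprB [in RHS]addrCA !addrA.
  by rewrite addrAC.
have -> : \sum_j scad lam a ((bh - u *: delta_mx i 0) j 0) =
    \sum_j scad lam a (bh j 0) - scad lam a u.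
  rewrite (bigD1 i)//= [in RHS](bigD1 i)//= -/u !mxE !eqxx -/u mulr1 subrr scad0//.
  rewrite add0r addrAC subrr add0r; apply: eq_bigr => j /negPf ji.
  by rewrite !mxE ji mulr0 subr0.
move: (e - _) (col i X) => x y.
by rewrite !l2norm_sqr !(dotDl, dotDr, dotZl, dotZr) (dotC y x); lra.
Qed.

(** The part of the argument free of probability. The bound on [dot e (X *m v)] expresses, without
    naming the projection, that the projected noise has norm at most [S]. *)
Lemma ls_scad_sparse (R : realType) (n k m : nat) (X : 'M[R]_(n, k + m))
    (beta bh : 'cV[R]_(k + m)) (e : 'cV[R]_n) (lam a rho S : R) :
  (0 < n)%N -> 0 < lam -> 2 < a -> 0 < rho <= 1 ->
  (forall v, n%:R * rho * l2norm v ^+ 2 <= l2norm (X *m v) ^+ 2) ->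
  (forall j, l2norm (col j X) ^+ 2 = n%:R) ->
  0 <= S -> (forall v, dot e (X *m v) <= S * l2norm (X *m v)) ->
  dsubmx beta = 0 ->
  is_ls_scad X (X *m beta + e) lam a bh ->
  8 * S < lam * Num.sqrt (n%:R * rho) ->
  (forall j, (2 * S + Num.sqrt (n%:R * k%:R * (a + 1) / 2) * lam) /
     Num.sqrt (n%:R * rho) + a * lam < `|usubmx beta j 0|) ->
  dsubmx bh = 0.
Proof.
move=> n0 lam0 a2 /andP[rho0 rho1] rhoP colP S0 eP beta2 argmin S_small beta_large.
have nR0 : 0 < n%:R :> R by rewrite ltr0n.
set r := Num.sqrt _ in S_small beta_large.
have r0 : 0 < r by rewrite sqrtr_gt0 mulr_gt0.
have rr : r ^+ 2 = n%:R * rho by rewrite sqr_sqrtr// ltW// mulr_gt0.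
pose del := bh - beta; pose N := l2norm (X *m del).
have N0 : 0 <= N by exact: l2norm_ge0.
have del_le j : `|del j 0| * r <= N.
  rewrite (@le_trans _ _ (l2norm del * r))//.
    by rewrite ler_wpM2r ?ler_norm_l2norm// ltW.
  rewrite -(ler_pXn2r (n := 2)) ?nnegrE ?mulr_ge0 ?l2norm_ge0 ?(ltW r0)//.
  by rewrite exprMn mulrC rr.
have basic := ls_scad_basic_inequality argmin.
rewrite -/del -/N !big_split_ord/= in basic.
have beta20 j : beta (rshift k j) 0 = 0.
  by have /matrixP/(_ j 0) := beta2; rewrite !mxE.
rewrite [X in _ + X - _]big1 ?addr0 in basic; last first.
  by move=> j _; rewrite beta20 scad0.
have sum_ge0 q (f : 'I_q -> 'I_(k + m)) :
    0 <= n%:R * \sum_j scad lam a (bh (f j) 0).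
  by apply: mulr_ge0 => //; apply: sumr_ge0 => j _; exact: scad_ge0.
have edel : dot e (X *m del) <= S * N by exact: eP.
set c := Num.sqrt _ * lam in beta_large.
have c0 : 0 <= c by rewrite mulr_ge0 ?sqrtr_ge0// ltW.
(* Otherwise both [N] and [N - 2 * S] exceed [c], while [c * c] is [n] times the total penalty of
   [k] coefficients on the plateau, which bounds [N * (N - 2 * S)]. *)
have N_le : N <= 2 * S + c.
  rewrite leNgt; apply/negP => lt_N.
  have : c * c < N * (N - 2 * S) by rewrite ltr_pM//; lra.
  have cc : c * c = n%:R * (k%:R * ((a + 1) * lam ^+ 2 / 2)).
    rewrite -expr2 exprMn sqr_sqrtr; last by rewrite divr_ge0// !mulr_ge0//; lra.
    by field.
  rewrite cc.
  have : \sum_(j < k) scad lam a (beta (lshift m j) 0) <=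
      k%:R * ((a + 1) * lam ^+ 2 / 2).
    rewrite -[k in leRHS]card_ord mulr_natl -sumr_const.
    by apply: ler_sum => j _; exact: scad_le.
  rewrite -(ler_pM2l nR0).
  have := sum_ge0 _ (@lshift k m); have := sum_ge0 _ (@rshift k m).
  by lra.
(* The estimation error is too small to bring [bh] below [a * lam] on the first block, so both
   values lie on the plateau. *)
have flat (j : 'I_k) :
    scad lam a (bh (lshift m j) 0) = scad lam a (beta (lshift m j) 0).
  have := beta_large j; rewrite mxE.
  have : `|del (lshift m j) 0| <= (2 * S + c) / r.
    by rewrite ler_pdivlMr// (le_trans (del_le _)).
  have : 0 <= (2 * S + c) / r by rewrite divr_ge0 ?(ltW r0)//; lra.
  rewrite /del !mxE => h0 h1 h2.
  rewrite !scad_large//; first by lra.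
  have := lerB_dist (beta (lshift m j) 0) (bh (lshift m j) 0).
  by rewrite distrC; lra.
(* The penalties of the first block now cancel, and that of the second block of [bh] enters with a
   favourable sign. *)
have {basic N_le} N_le : N <= 2 * S.
  rewrite leNgt; apply/negP => lt_N.
  move: basic; rewrite (eq_bigr _ (fun j _ => flat j)).
  have : 0 < N * (N - 2 * S) by rewrite mulr_gt0//; lra.
  have := sum_ge0 _ (@rshift k m).
  by lra.
apply/matrixP => j z; rewrite ord1 !mxE {z}; set i := rshift k j; set u := bh i 0.
apply/eqP; rewrite -normr_eq0 eq_le normr_ge0 andbT leNgt; apply/negP => u0.
have du : del i 0 = u by rewrite /del !mxE beta20 subr0.
have u_le : `|u| * r <= 2 * S by rewrite -du (le_trans (del_le i)).
(* This puts [u] in the linear part of the penalty, with a margin used at the end. *)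
have u_lt : 4 * `|u| < lam by rewrite -(ltr_pM2r r0) -mulrA; lra.
have := ls_scad_coordinate_inequality i lam0 argmin.
rewrite -/u -/del scad_small; last by have := normr_ge0 u; lra.
rewrite colP dotDl dotNl.
pose t := Num.sqrt (n%:R : R).
have t0 : 0 < t by rewrite sqrtr_gt0.
have tt : t ^+ 2 = n%:R by rewrite sqr_sqrtr.
have coli : l2norm (col i X) = t by rewrite /t -(colP i) sqrtr_sqr ger0_norm ?l2norm_ge0.
have r_le : r <= t by rewrite ler_wsqrtr// ger_pMr.
(* The one-sided noise bound is applied to both signs of the basis vector. *)
have e_le : `|dot e (col i X)| <= S * t.
  rewrite ler_norml -coli colE eP andbT lerNl.
  have := eP (- delta_mx i 0); rewrite mulmxN dotNr.
  by rewrite /l2norm; under eq_bigr do rewrite mxE sqrrN.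
have d_le : `|dot (X *m del) (col i X)| <= 2 * S * t.
  by rewrite (le_trans (cauchy_schwarz _ _))// coli ler_wpM2r// ltW.
have uz : u * (dot e (col i X) - dot (X *m del) (col i X)) <= `|u| * (3 * (S * t)).
  rewrite (le_trans (ler_norm _))// normrM ler_wpM2l// (le_trans (ler_normB _ _))//.
  by lra.
rewrite -[u ^+ 2]real_normK ?num_real// => h.
have : `|u| * (n%:R * lam) <= `|u| * (6 * (S * t) + n%:R * `|u|) by lra.
rewrite (ler_pM2l u0) -tt => {}h.
have : t * (t * lam) <= t * (6 * S + t * `|u|) by lra.
rewrite (ler_pM2l t0) => {}h.
(* Now 6 S is below three quarters of [lam * t] and [t * |u|] below one quarter, against the
   inequality just derived. *)
have : 8 * S < lam * t by rewrite (lt_le_trans S_small)// ler_wpM2l// ltW.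
have : 4 * `|u| * t < lam * t by rewrite ltr_pM2r.
by lra.
Qed.

(** * Sparsity with probability tending to one *)

Lemma min_abs_le (R : realType) (k : nat) (v : 'cV[R]_k) j :
  min_abs v <= `|v j 0|.
Proof. by apply: ge_inf; [exists 0 => _ [i _ <-]|exists j]. Qed.

Lemma min_abs_gt0 (R : realType) (k : nat) (v : 'cV[R]_k) :
  (0 < k)%N -> (forall j, v j 0 != 0) -> 0 < min_abs v.
Proof.
move=> k0 v0; pose j0 := Ordinal k0.
have [j _ jP] := Order.TotalTheory.arg_minP (fun j => `|v j 0|) (erefl : xpredT j0).
apply: (@lt_le_trans _ _ `|v j 0|); first by rewrite normr_gt0.
apply: lb_le_inf; first by exists `|v j0 0|, j0.
by move=> _ [i _ <-]; exact: jP.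
Qed.

Section probability_bounds.
Context (d : measure_display) (T : measurableType d) (R : realType).
Variable P : probability T R.

Lemma cvg_probability1 (A : nat -> set T) :
  (forall e : R, 0 < e -> \forall n \near \oo, ((1 - e)%:E <= P (A n))%E) ->
  (forall n, measurable (A n)) ->
  P (A n) @[n --> \oo] --> 1%E.
Proof.
move=> A1 mA; apply/fine_cvgP; split.
  by near=> n; exact: fin_num_measure.
apply/cvgrPdist_le => e /A1; apply: filterS => n /=.
have Afin : P (A n) \is a fin_num by exact: fin_num_measure.
have : (P (A n) <= 1)%E by exact: probability_le1.
rewrite -(fineK Afin) !lee_fin /= => le1 ge1.
by rewrite ger0_norm; lra.
Unshelve. all: by end_near. Qed.

Lemma measurable_dsubmx_eq0 (k m : nat) (V : T -> 'cV[R]_(k + m)) :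
  random_vector V -> measurable [set w | dsubmx (V w) = 0].
Proof.
move=> mV.
have -> : [set w | dsubmx (V w) = 0] =
    \bigcap_(j in [set: 'I_m]) ((fun w => V w (rshift k j) 0) @^-1` [set 0]).
  apply/seteqP; split => w /=.
    by move=> /matrixP V0 j _; have := V0 j 0; rewrite !mxE.
  by move=> V0; apply/matrixP => j z; rewrite ord1 !mxE; exact: V0.
apply: fin_bigcap_measurable; first exact: finite_finset.
by move=> j _; rewrite -[X in measurable X]setTI; exact: mV.
Qed.

(** The failure probability is the Markov bound for the squared norm of the projected noise at level
    [S ^+ 2], the projection having trace [k + m]. *)
Lemma ls_scad_sparse_probability (n k m : nat) (X : 'M[R]_(n, k + m))
    (beta : 'cV[R]_(k + m)) (e : 'I_n -> {RV P >-> R})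
    (bh : T -> 'cV[R]_(k + m)) (lam a s S : R)
    (rho := min_eigenvalue (gram X)) :
  (0 < n)%N -> 0 < lam -> 2 < a -> 0 < rho <= 1 ->
  (forall j, l2norm (col j X) ^+ 2 = n%:R) ->
  mutually_independent e -> (forall i, 'E_P[e i] = 0)%E ->
  (forall i, 'V_P[e i] = s%:E)%E ->
  dsubmx beta = 0 ->
  random_vector bh ->
  (forall w, is_ls_scad X (X *m beta + \col_i e i w) lam a (bh w)) ->
  0 < S ->
  8 * S < lam * Num.sqrt (n%:R * rho) ->
  (forall j, (2 * S + Num.sqrt (n%:R * k%:R * (a + 1) / 2) * lam) /
     Num.sqrt (n%:R * rho) + a * lam < `|usubmx beta j 0|) ->
  ((1 - s * (k + m)%:R / S ^+ 2)%:E <= P [set w | dsubmx (bh w) = 0%R])%E.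
Proof.
move=> n0 lam0 a2 rho01 colX indep mean var beta2 mbh argmin S0 S_small beta_large.
have [|A [AT AA AX trA]] := @column_space_projection _ _ _ X n0.
  by case/andP: rho01.
have dotA v : dot v (A *m v) = l2norm (A *m v) ^+ 2.
  by rewrite l2norm_sqr dot_mulmxl AT mulmxA AA.
pose q w := dot (\col_i e i w) (A *m \col_i e i w).
pose B := [set w | S ^+ 2 <= q w].
have mB : measurable B.
  rewrite [B](_ : _ = q @^-1` `[S ^+ 2, +oo[%classic).
    by rewrite -[X in measurable X]setTI; exact: measurable_quadratic_form.
  by apply/seteqP; split => w /=; rewrite in_itv/= andbT.
have PB : (P B <= (s * (k + m)%:R / S ^+ 2)%:E)%E.
  rewrite -trA; apply: quadratic_form_tail => //; last by rewrite exprn_gt0.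
  by move=> v; rewrite dotA sqr_ge0.
apply: (@le_trans _ _ (P (~` B))).
  by rewrite probability_setC// EFinB leeB.
apply: le_measure; rewrite ?inE; [exact: measurableC|exact: measurable_dsubmx_eq0|].
move=> w /negP /=; rewrite -ltNge => qS.
apply: (@ls_scad_sparse _ _ _ _ X beta (bh w) (\col_i e i w) lam a rho S) => //.
- by move=> v; exact: min_eigenvalue_gram.
- exact: ltW.
(* As [A] is symmetric and fixes [X], it can be moved onto the noise before Cauchy-Schwarz. *)
- move=> v; rewrite -AX -mulmxA -[in dot _ (A *m _)]AT -dot_mulmxl.
  rewrite (le_trans (ler_norm _))// (le_trans (cauchy_schwarz _ _))//.
  rewrite mulmxA AX ler_wpM2r ?l2norm_ge0//.
  by rewrite -(ler_pXn2r (n := 2)) ?nnegrE ?l2norm_ge0 ?(ltW S0)// -dotA ltW.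
Qed.

End probability_bounds.

Theorem theorem3 (R : realType) (d : measure_display) (T : measurableType d)
  (P : probability T R)
  (k m : nat -> nat)
  (X : forall n : nat, 'M[R]_(n, k n + m n))
  (beta : forall n : nat, 'cV[R]_(k n + m n))
  (eps : forall n : nat, 'I_n -> {RV P >-> R})
  (Y : forall n : nat, T -> 'cV[R]_n)
  (lambda : nat -> R) (a sigma : R)
  (betahat : forall n : nat, T -> 'cV[R]_(k n + m n))
  (a_gt2 : 2 < a)
  (lambda_gt0 : forall n : nat, 0 < lambda n)
  (beta1_neq0 : forall (n : nat) (j : 'I_(k n)), usubmx (beta n) j 0 != 0)
  (beta2_eq0 : forall n : nat, dsubmx (beta n) = 0)
  (model : forall (n : nat) (w : T),
     Y n w = X n *m beta n + \col_(i < n) eps n i w)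
  (betahat_rv : forall n : nat, random_vector (betahat n))
  (betahat_argmin : forall (n : nat) (w : T),
     is_ls_scad (X n) (Y n w) (lambda n) a (betahat n w))
  (rho := fun n : nat => min_eigenvalue (gram (X n)))
  (pi := fun n : nat => max_eigenvalue (gram (lsubmx (X n))))
  (omega := fun n : nat => max_eigenvalue (gram (rsubmx (X n))))
  (p := fun n : nat => (k n + m n)%N)
  (beta_min := fun n : nat => min_abs (usubmx (beta n)))
  (rho_gt0 : \forall n \near \oo, 0 < rho n)
  (eps_indep : forall n : nat, mutually_independent (eps n))
  (eps_ident : forall (n n' : nat) (i : 'I_n) (i' : 'I_n'),
     identically_distributed (eps n i) (eps n' i'))
  (eps_mean : forall (n : nat) (i : 'I_n), 'E_P[eps n i]%E = 0%E)
  (eps_var : forall (n : nat) (i : 'I_n), 'V_P[eps n i]%E = (sigma ^+ 2)%:E)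
  (col_norm : forall (n : nat) (j : 'I_(k n + m n)),
     l2norm (col j (X n)) ^+ 2 = n%:R)
  (cond_iii1 :
     (fun n => Num.sqrt (k n)%:R * lambda n / Num.sqrt (rho n))
       @ \oo --> (0 : R))
  (cond_iii2 :
     (fun n => Num.sqrt (p n)%:R / Num.sqrt (n%:R * rho n)) @ \oo --> (0 : R))
  (cond_iv1 :
     (fun n => Num.sqrt (k n)%:R * lambda n / (Num.sqrt (rho n) * beta_min n))
       @ \oo --> (0 : R))
  (cond_iv2 :
     (fun n => Num.sqrt (p n)%:R / (Num.sqrt (n%:R * rho n) * beta_min n))
       @ \oo --> (0 : R))
  (cond_iv3 :
     (fun n => Num.sqrt ((p n)%:R / n%:R) / rho n) @ \oo --> (0 : R))
  (cond_v :
     (fun n => Num.sqrt (Num.max (pi n) (omega n) * (p n)%:R) /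
                 (Num.sqrt n%:R * rho n * lambda n)) @ \oo --> (0 : R)) :
  (fun n => P [set w : T | dsubmx (betahat n w) = 0]) @ \oo --> 1%E.
Proof.
apply: cvg_probability1 => [e e0|n]; last exact: measurable_dsubmx_eq0.
(* With [S] equal to [sqrt M] times [sqrt p], the failure bound is [sigma ^+ 2 / M], at most [e];
   the added 1 keeps [M] positive when [sigma] is 0. *)
pose M := (sigma ^+ 2 + 1) / e.
have M0 : 0 < M by rewrite divr_gt0// ltr_wpDl// sqr_ge0.
pose q := Num.sqrt M.
have q0 : 0 < q by rewrite sqrtr_gt0.
(* These thresholds yield [8 * S < lambda n * r] and make each of the three terms compared with
   [beta_min n] smaller than a quarter of it. *)
have c1 : 0 < (8 * q)^-1 by rewrite invr_gt0 mulr_gt0.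
have c2 : 0 < (4 * a)^-1 by rewrite invr_gt0 mulr_gt0//; lra.
near=> n.
have n0 : (0 < n)%N by near: n; exists 1%N.
have rho0 : 0 < rho n by near: n.
have v_lt : `|Num.sqrt (Num.max (pi n) (omega n) * (p n)%:R) /
    (Num.sqrt n%:R * rho n * lambda n)| < (8 * q)^-1.
  by near: n; exact: cvgr0_norm_lt.
have iv1_lt : `|Num.sqrt (k n)%:R * lambda n / (Num.sqrt (rho n) * beta_min n)|
    < (4 * a)^-1.
  by near: n; exact: cvgr0_norm_lt.
have iv2_lt : `|Num.sqrt (p n)%:R / (Num.sqrt (n%:R * rho n) * beta_min n)|
    < (8 * q)^-1.
  by near: n; exact: cvgr0_norm_lt.
(* With an empty second block the event is sure; otherwise a column of that block gives the bounds
   of [rho n] and [omega n] by 1. *)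
have [m0|m0] := posnP (m n).
  rewrite (_ : [set w | _] = setT) ?probability_setT ?lee_fin; first by lra.
  apply/seteqP; split => w //= _; apply/matrixP => j.
  by have := leq_trans (ltn_ord j) (eq_leq m0).
pose j0 := Ordinal m0.
have rho1 : rho n <= 1.
  exact: (min_eigenvalue_gram_le1 n0 (col_norm n (rshift (k n) j0))).
have omega1 : 1 <= omega n.
  apply: (max_eigenvalue_gram_ge1 (j := j0) n0).
  rewrite -(col_norm n (rshift (k n) j0)); congr (l2norm _ ^+ 2).
  by apply/matrixP => i z; rewrite !mxE.
pose P' := Num.sqrt ((p n)%:R : R); pose r := Num.sqrt (n%:R * rho n).
have pR0 : 0 < (p n)%:R :> R by rewrite ltr0n addn_gt0 m0 orbT.
have P'0 : 0 < P' by rewrite sqrtr_gt0.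
have nR0 : 0 < n%:R :> R by rewrite ltr0n.
have r0 : 0 < r by rewrite sqrtr_gt0 mulr_gt0.
have l0 := lambda_gt0 n.
pose sr := Num.sqrt (rho n).
have sr0 : 0 < sr by rewrite sqrtr_gt0.
have sr1 : sr <= 1 by rewrite -sqrtr1 ler_wsqrtr.
have rE : r = Num.sqrt n%:R * sr by rewrite /r sqrtrM// ltW.
have sn0 : 0 < Num.sqrt (n%:R : R) by rewrite sqrtr_gt0.
(* Condition (v) is used here: the maximum is at least 1, and [rho n] is at most its square root. *)
have small : 8 * (q * P') < lambda n * r.
  have P'_le : P' <= Num.sqrt (Num.max (pi n) (omega n) * (p n)%:R).
    by rewrite ler_wsqrtr// ler_peMl ?(ltW pR0)// le_max omega1 orbT.
  have := le_lt_trans (ler_norm _) v_lt.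
  rewrite ltr_pdivrMr ?mulr_gt0// => /(le_lt_trans P'_le).
  rewrite mulrC ltr_pdivlMr ?mulr_gt0// => h.
  have -> : 8 * (q * P') = P' * (8 * q) by ring.
  apply: lt_le_trans h _; rewrite rE mulrC ler_pM2l// ler_pM2l//.
  by rewrite -(sqr_sqrtr (ltW rho0)) -/sr expr2 ger_pMr.
have large j : (2 * (q * P') + Num.sqrt (n%:R * (k n)%:R * (a + 1) / 2) * lambda n)
    / r + a * lambda n < `|usubmx (beta n) j 0|.
  (* The index [j] makes the first block nonempty, so [beta_min n] is a true positive minimum and
     not the default 0. *)
  have k0 : (0 < k n)%N by exact: leq_ltn_trans (ltn_ord j).
  apply: lt_le_trans (min_abs_le _ j); rewrite -[min_abs _]/(beta_min n).
  have b0 : 0 < beta_min n by apply: min_abs_gt0.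
  pose sk := Num.sqrt ((k n)%:R : R).
  have sk1 : 1 <= sk by rewrite -sqrtr1 ler_wsqrtr// ler1n.
  have a0 : 0 < a by lra.
  pose y := sk * lambda n / sr.
  have y_lt : y * (4 * a) < beta_min n.
    have := le_lt_trans (ler_norm _) iv1_lt.
    rewrite ltr_pdivrMr ?mulr_gt0// [ltRHS]mulrC ltr_pdivlMr ?mulr_gt0//.
    by move=> h; rewrite /y mulrAC ltr_pdivrMr// [ltRHS]mulrC.
  have y_ge : lambda n <= y.
    by rewrite /y ler_pdivlMr// mulrC ler_pM2r// (le_trans sr1).
  have P'_lt : P' / r * (8 * q) < beta_min n.
    have := le_lt_trans (ler_norm _) iv2_lt.
    rewrite ltr_pdivrMr ?mulr_gt0// [ltRHS]mulrC ltr_pdivlMr ?mulr_gt0//.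
    by rewrite mulrAC ltr_pdivrMr// [beta_min n * _]mulrC.
  (* The constant is absorbed through (a + 1) / 2 <= a^2, so condition (iv) on [y] controls this
     term too. *)
  have root_le : Num.sqrt (n%:R * (k n)%:R * (a + 1) / 2) * lambda n / r <= a * y.
    have -> : a * y = a * sk * Num.sqrt n%:R * lambda n / r.
      by rewrite /y rE; field; rewrite !gt_eqF.
    rewrite ler_pM2r ?invr_gt0// ler_pM2r//.
    rewrite -(ler_pXn2r (n := 2)) ?nnegrE ?mulr_ge0 ?sqrtr_ge0// ?(ltW a0)//.
    rewrite !exprMn !sqr_sqrtr ?divr_ge0 ?mulr_ge0//; last by lra.
    have nk0 : 0 <= n%:R * (k n)%:R :> R by rewrite mulr_ge0.
    have : (a + 1) / 2 <= a ^+ 2 by nra.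
    by move=> /(ler_wpM2l nk0); lra.
  rewrite mulrDl.
  have -> : 2 * (q * P') / r = P' / r * (8 * q) / 4 by field; rewrite gt_eqF.
  have : a * lambda n <= a * y by rewrite ler_pM2l.
  by lra.
have S0 : 0 < q * P' by rewrite mulr_gt0.
have argmin w : is_ls_scad (X n) (X n *m beta n + \col_i eps n i w) (lambda n) a
    (betahat n w) by rewrite -model.
have := ls_scad_sparse_probability n0 l0 a_gt2 _ (col_norm n) (eps_indep n)
  (eps_mean n) (eps_var n) (beta2_eq0 n) (betahat_rv n) argmin S0 small large.
rewrite rho0 rho1 => /(_ isT); apply: le_trans; rewrite lee_fin lerB//.
(* The dimension cancels between the trace and [S ^+ 2]. *)
rewrite exprMn !sqr_sqrtr ?(ltW M0)// -mulf_div divff ?gt_eqF// mulr1.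
rewrite /M invf_div mulrA ler_pdivrMr ?ltr_wpDl ?sqr_ge0//.
by rewrite mulrC ler_pM2l// lerDl.
Unshelve. all: by end_near. Qed.
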